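(* Fix $f\in\widehat{\mathcal M}_1$. Then $$\sup_{g\in\widehat{\mathcal M}_1}P_{f,g}=\int_0^1\ \sup_{u\ge0}\left(\int_0^1\varepsilon(f(y)x)\,\varepsilon(uy)\,\mathrm dy\right)\mathrm dx.$$
   Context: $\widehat{\mathcal M}_1$ is the set of measurable non-negative (real-valued) functions on $[0,1]$. For real $x$, $\varepsilon(x):=\lfloor x\rfloor-2\lfloor x/2\rfloor\in\{0,1\}$. For $f,g\in\widehat{\mathcal M}_1$, $$P_{f,g}:=\int_{[0,1]^2}\varepsilon(f(y)x)\,\varepsilon(g(x)y)\,\mathrm dx\,\mathrm dy.$$ *)

(* Defs.v *)
From mathcomp Require Import all_boot all_order all_algebra.
From mathcomp Require Import all_classical all_reals all_analysis.

Set Implicit Arguments.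
Unset Strict Implicit.
Unset Printing Implicit Defensive.

Import Order.TTheory GRing.Theory Num.Theory.
Import numFieldNormedType.Exports.

Local Open Scope classical_set_scope.
Local Open Scope ring_scope.

(* Functions on [0, 1] are represented by total functions R -> R, whose values
   outside [0, 1] are unconstrained and never used; measurable means Borel. *)
Definition M1 (R : realType) : set (R -> R) :=
  [set f : R -> R | measurable_fun (`[0, 1] : set R) f /\
                    forall x, x \in `[0, 1] -> 0 <= f x].

Definition eps (R : realType) (x : R) : R :=
  (Num.floor x - 2 * Num.floor (x / 2))%:~R.

(* The pair z is (x, y). *)
Definition Pfg (R : realType) (f g : R -> R) : \bar R :=
  (\int[lebesgue_measure \x lebesgue_measure]_(z in `[0%R, 1%R] `*` `[0%R, 1%R])
     (eps (f z.2 * z.1) * eps (g z.1 * z.2))%:E)%E.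

(* Main.v *)
Require Import Defs.
From mathcomp Require Import all_boot all_order all_algebra.
From mathcomp Require Import all_classical all_reals all_analysis.
From mathcomp Require Import measurable_realfun.
From mathcomp Require Import zify lra.

(** Write [slice f x u] for the inner integral
    int_0^1 eps (f y * x) * eps (u * y) dy.  Tonelli gives
    [Pfg f g] = int_0^1 [slice f x (g x)] dx ([Pfg_slice]), which is at most the
    integral of the pointwise supremum of [slice f x u] over u >= 0.  For the
    converse one would like g to pick, for each x, a maximising u; such a u need
    not exist, and the choice has to be measurable in x.

    Both obstacles disappear once u ranges over a countable set.  The parity
    function [eps] is continuous from the right, and u * y decreases to its limit
    when u does because y >= 0, so by dominated convergence [slice f x] is
    continuous from the right too ([slice_cvg_right]).  Hence its supremum over
    u >= 0 is already its supremum over the nonnegative rationals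
    ([ereal_sup_slice_nnratr]).  Along an enumeration q_0, q_1, ... of these,
    let g_n x be a maximiser of [slice f x] among q_0, ..., q_n
    ([running_argmax]).  Each g_n is measurable, being obtained by finitely many
    comparisons of measurable functions, and [slice f x (g_n x)] increases to the
    supremum for every x; monotone convergence then yields that [Pfg f g_n] tends
    to the right-hand side. *)

Import Order.TTheory GRing.Theory Num.Theory.
Import numFieldNormedType.Exports.

Local Open Scope classical_set_scope.
Local Open Scope ring_scope.

Section parity.
Context {R : realType}.
Implicit Types t s : R.

(** This is what makes [eps t] the parity, 0 or 1, of [Num.floor t]. *)
Lemma floor_half_bounds t :
  2 * Num.floor (t / 2) <= Num.floor t < 2 * Num.floor (t / 2) + 2.
Proof.
have /andP[l1 l2] := floor_itv (t / 2).
rewrite floor_ge_int floor_lt_int !rmorphD !rmorphM /=.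
by move: l1 l2; rewrite rmorphD /= => *; apply/andP; split; lra.
Qed.

Lemma eps_ge0 t : 0 <= eps t.
Proof. by rewrite ler0z subr_ge0; case/andP: (floor_half_bounds t). Qed.

Lemma eps_le1 t : eps t <= 1.
Proof.
rewrite -[1 in leRHS]/(1%:~R) ler_int.
by case/andP: (floor_half_bounds t) => _; lia.
Qed.

(** The jumps of [eps] occur at integers only, so [eps] keeps its value from [t]
    up to the next integer after [t]; being one-sided, this also holds at an
    integer [t]. *)
Lemma eps_right_constant t s :
  t <= s -> s < (Num.floor t + 1)%:~R -> eps s = eps t.
Proof.
move=> ts st.
have fs : Num.floor s = Num.floor t.
  by apply/eqP; rewrite floor_eq st andbT (le_trans (floor_le t)).
have fs2 : Num.floor (s / 2) = Num.floor (t / 2).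
  have /andP[l1 l2] := floor_half_bounds t.
  have /andP[m1 m2] := floor_itv (t / 2).
  apply/eqP; rewrite floor_eq (le_trans m1) ?ler_pM2r//=.
  rewrite ltr_pdivrMr//; apply: lt_le_trans st _.
  (* The next integer after [t] does not exceed the next even one. *)
  rewrite (_ : _ * 2 = ((Num.floor (t / 2) + 1) * 2)%:~R); last by rewrite intrM.
  by rewrite ler_int; lia.
by rewrite /eps fs fs2.
Qed.

Lemma measurable_eps : measurable_fun setT (@eps R).
Proof.
have mfl : measurable_fun setT (fun t : R => (Num.floor t)%:~R : R).
  apply: nondecreasing_measurable => // s t st.
  by rewrite ler_int le_floor.
rewrite (_ : @eps R = (fun t => (Num.floor t)%:~R - 2 * (Num.floor (t / 2))%:~R)).
  apply: measurable_funB => //; apply: measurable_funM => //.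
  by apply: (measurableT_comp mfl); exact: mulrr_measurable.
by apply/funext => t; rewrite /eps rmorphB rmorphM.
Qed.

Lemma eps_cvg_right (v : R^nat) t :
  (forall n, t <= v n) -> v @ \oo --> t -> eps (v n) @[n --> \oo] --> eps t.
Proof.
move=> tv vt; apply: cvg_near_cst.
have lt1 : t < (Num.floor t + 1)%:~R by case/andP: (floor_itv t).
near=> n; apply: eps_right_constant => //.
by near: n; apply: cvgr_lt lt1.
Unshelve. all: by end_near. Qed.

End parity.

Section slices.
Context {R : realType}.
Notation mu := (@lebesgue_measure R).
Notation I := (`[0%R, 1%R]%classic : set R).
Implicit Types f g : R -> R.

Definition slice f (x u : R) : \bar R :=
  (\int[mu]_(y in `[0%R, 1%R]) (eps (f y * x) * eps (u * y))%:E)%E.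

Lemma slice_ge0 f x u : (0 <= slice f x u)%E.
Proof. by apply: integral_ge0 => y _; rewrite lee_fin mulr_ge0// eps_ge0. Qed.

Lemma measurable_slice_integrand f x u : measurable_fun I f ->
  measurable_fun I (fun y => (eps (f y * x) * eps (u * y))%:E).
Proof.
move=> mf; apply/measurable_EFinP/measurable_funM.
  apply: (measurableT_comp measurable_eps).
  by apply: measurable_funM => //.
by apply: (measurableT_comp measurable_eps); exact: mulrl_measurable.
Qed.

Section tonelli.
Variables f g : R -> R.
Hypotheses (mf : measurable_fun I f) (mg : measurable_fun I g).
Let F (z : R * R) : \bar R := (eps (f z.2 * z.1) * eps (g z.1 * z.2))%:E.

Let mF : measurable_fun setT (F \_ (I `*` I)).
Proof.
have mD : measurable (I `*` I) by exact: measurableX.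
apply/(measurable_restrictT _ mD)/measurable_EFinP.
have mf2 : measurable_fun (I `*` I) (fun z : R * R => f z.2).
  apply: (@measurable_comp _ _ _ _ _ _ I f _ snd) => //.
  - by move=> _ [z [_ ? <-]].
  - by apply: measurable_funTS; exact: measurable_snd.
have mg1 : measurable_fun (I `*` I) (fun z : R * R => g z.1).
  apply: (@measurable_comp _ _ _ _ _ _ I g _ fst) => //.
  - by move=> _ [z [? _ <-]].
  - by apply: measurable_funTS; exact: measurable_fst.
apply: measurable_funM; apply: (measurableT_comp measurable_eps);
  apply: measurable_funM => //.
  - by apply: measurable_funTS; exact: measurable_fst.
  - by apply: measurable_funTS; exact: measurable_snd.
Qed.

Let F_ge0 z : (0 <= (F \_ (I `*` I)) z)%E.
Proof. by rewrite patchE; case: ifP => // _; rewrite lee_fin mulr_ge0// eps_ge0. Qed.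

(* Extending the integrand by 0 outside the square turns the integral over the
   square into one over the whole plane, to which Tonelli's theorem applies. *)
Let fubini_F_slice :
  fubini_F mu (F \_ (I `*` I)) = (fun x => slice f x (g x)) \_ I.
Proof.
apply/funext => x; rewrite /fubini_F patchE; case: ifPn => xI.
  rewrite /slice [RHS]integral_mkcond; apply: eq_integral => y _.
  by rewrite !patchE in_setX /= xI.
rewrite -[RHS](integral0 mu setT); apply: eq_integral => y _.
by rewrite patchE in_setX /= (negbTE xI).
Qed.

Lemma measurable_slice : measurable_fun I (fun x => slice f x (g x)).
Proof.
apply/(measurable_restrictT _ (measurable_itv _)).
have := measurable_fun_fubini_tonelli_F (m2 := mu) _ mF F_ge0.
by congr (measurable_fun _ _); exact: fubini_F_slice.
Qed.

Lemma Pfg_slice : Pfg f g = (\int[mu]_(x in `[0%R, 1%R]) slice f x (g x))%E.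
Proof.
rewrite /Pfg integral_mkcond [RHS]integral_mkcond fubini_tonelli1//.
by congr (integral _ _ _); exact: fubini_F_slice.
Qed.

End tonelli.

(** Dominated convergence, with dominating function 1.  Approaching [u] from the
    right is essential for pointwise convergence of the integrand at every [y];
    [y >= 0] is what transfers it to [u * y]. *)
Lemma slice_cvg_right f x u (v : R^nat) : measurable_fun I f ->
  (forall n, u <= v n) -> v @ \oo --> u ->
  slice f x (v n) @[n --> \oo] --> slice f x u.
Proof.
move=> mf uv vu; apply: (@dominated_cvg _ _ _ _ _ _ _ _ (cst 1%E)) => //.
- by move=> n; exact: measurable_slice_integrand.
- move=> y; rewrite /= in_itv/= => /andP[y0 _].
  apply: cvg_EFin; first by apply: nearW.
  apply: cvgMl_tmp; apply: eps_cvg_right; last exact: cvgMr_tmp.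
  by move=> n; rewrite ler_wpM2r.
- apply/integrableP; split; first exact: measurable_cst.
  under eq_integral do rewrite /= normr1.
  by rewrite integral_cst//= lebesgue_measure_itv/= lte01 mul1e ltry.
- move=> n y _; rewrite /= lee_fin ger0_norm ?mulr_ge0 ?eps_ge0//.
  by rewrite mulr_ile1 ?eps_ge0 ?eps_le1.
Qed.

(** An enumeration, with repetitions, of the nonnegative rationals; numbers that
    code no rational are sent to 0. *)
Definition nnratr (n : nat) : R := `|ratr (odflt 0 (unpickle n : option rat))|.

Lemma nnratr_in_itvoo (a b : R) : 0 <= a -> a < b -> exists n, a < nnratr n < b.
Proof.
move=> a0 /rat_in_itvoo[p]; rewrite in_itv/= => /andP[ap pb].
exists (pickle p); rewrite /nnratr pickleK /= ger0_norm ?ap//.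
exact: le_trans a0 (ltW ap).
Qed.

(** Every [u >= 0] is a limit of rationals from the right, along which [slice f x]
    converges to [slice f x u].  This makes the supremum a countable one, hence
    measurable in [x] and within reach of a greedy selection. *)
Lemma ereal_sup_slice_nnratr f x : measurable_fun I f ->
  ereal_sup [set slice f x u | u in [set u : R | 0 <= u]] =
  ereal_sup (range (fun n => slice f x (nnratr n))).
Proof.
move=> mf; apply/eqP; rewrite eq_le; apply/andP; split; last first.
  by apply: ereal_sup_le => _ [n _ <-]; exists (nnratr n) => //; exact: normr_ge0.
apply: ge_ereal_sup => _ [u /= u0 <-].
have /choice[s us] : forall n, exists k, u < nnratr k < u + harmonic n.
  by move=> n; apply: nnratr_in_itvoo => //; rewrite ltrDl invr_gt0.
have : slice f x (nnratr (s n)) @[n --> \oo] --> slice f x u.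
  apply: slice_cvg_right => // [n|]; first by case/andP: (us n) => /ltW.
  apply: (@squeeze_cvgr _ _ _ _ (cst u) (fun n => u + harmonic n)).
  - by apply: nearW => n; case/andP: (us n) => /ltW -> /ltW ->.
  - exact: cvg_cst.
  - by rewrite -[u in _ --> u]addr0; apply: cvgD; [exact: cvg_cst|exact: cvg_harmonic].
move/cvge_to_le; apply; apply: nearW => n.
by apply: ereal_sup_ubound; exists (s n).
Qed.

End slices.

Section running_argmax.
Context {d d'} {T : measurableType d} {U : measurableType d'} {R : realType}.
Variables (h : T -> U -> \bar R) (q : nat -> U).

(** A maximiser of [h t] among [q 0], ..., [q n], the earliest one in case of ties:
    the current candidate is replaced only by a strictly better one. *)
Fixpoint running_argmax (n : nat) (t : T) : U :=
  if n is m.+1 then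
    let u := running_argmax m t in if (h t u < h t (q n))%E then q n else u
  else q 0.

Lemma running_argmax_in_range n t : range q (running_argmax n t).
Proof. by elim: n => [|n ih] /=; [exists 0%N|case: ifP => // _; exists n.+1]. Qed.

Lemma running_argmax_nondecreasing t :
  {homo (fun n => h t (running_argmax n t)) : m n / (m <= n)%N >-> (m <= n)%E}.
Proof.
apply: homo_leq => [? //|? ? ?|n /=]; first exact: le_trans.
by case: ifP => // /ltW.
Qed.

Lemma running_argmax_ge t n : (h t (q n) <= h t (running_argmax n t))%E.
Proof. by case: n => [|n] //=; case: ltP. Qed.

Lemma running_argmax_cvg t :
  h t (running_argmax n t) @[n --> \oo] --> ereal_sup (range (fun n => h t (q n))).
Proof.
suff <- : ereal_sup (range (fun n => h t (running_argmax n t))) =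
          ereal_sup (range (fun n => h t (q n))).
  exact: ereal_nondecreasing_cvgn (running_argmax_nondecreasing t).
apply/eqP; rewrite eq_le; apply/andP; split.
  apply: ereal_sup_le => _ [n _ <-].
  by have [k _ <-] := running_argmax_in_range n t; exists k.
apply: ge_ereal_sup => _ [n _ <-]; apply: le_trans (running_argmax_ge t n) _.
by apply: ereal_sup_ubound; exists n.
Qed.

(** The hypothesis on [h] asks for measurability only along measurable selections
    [g], which is what Tonelli's theorem provides for [slice], and is exactly what
    the comparison at each step needs. *)
Lemma measurable_running_argmax (D : set T) : measurable D ->
  (forall g, measurable_fun D g -> measurable_fun D (fun t => h t (g t))) ->
  forall n, measurable_fun D (running_argmax n).
Proof.
move=> mD mh; elim=> [|n ih] /=; first exact: measurable_cst.
apply: measurable_fun_if => //.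
  by apply: measurable_fun_lte; apply: mh.
exact: measurable_funS ih.
Qed.

End running_argmax.

Theorem theorem36 (R : realType) (f : R -> R) (hf : M1 f) :
  ereal_sup [set Pfg f g | g in @M1 R] =
  (\int[lebesgue_measure]_(x in `[0%R, 1%R])
     ereal_sup
       [set \int[lebesgue_measure]_(y in `[0%R, 1%R])
              (eps (f y * x) * eps (u * y))%:E
        | u in [set u : R | (0 <= u)%R]])%E.
Proof.
case: hf => mf _.
pose S x := ereal_sup [set slice f x u | u in [set u : R | 0 <= u]].
rewrite -[RHS]/(\int[lebesgue_measure]_(x in `[0%R, 1%R]) S x)%E.
pose r := running_argmax (slice f) nnratr.
have mI : measurable (`[0%R, 1%R]%classic : set R) by [].
have mr n : measurable_fun (`[0%R, 1%R]%classic : set R) (r n).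
  by apply: measurable_running_argmax => // g; exact: measurable_slice.
have msr n : measurable_fun (`[0%R, 1%R]%classic : set R) (fun x => slice f x (r n x)).
  exact: measurable_slice.
have rS x : slice f x (r n x) @[n --> \oo] --> S x.
  by rewrite /S ereal_sup_slice_nnratr//; exact: running_argmax_cvg.
apply/eqP; rewrite eq_le; apply/andP; split.
  apply: ge_ereal_sup => _ [g [mg g0] <-]; rewrite Pfg_slice//.
  apply: ge0_le_integral => //.
  - by move=> x _; exact: slice_ge0.
  - exact: measurable_slice.
  - exact: (emeasurable_fun_cvg (fun n x => slice f x (r n x))).
  - by move=> x xI; apply: ereal_sup_ubound; exists (g x) => //; exact: g0.
have : (\int[lebesgue_measure]_(x in `[0%R, 1%R]) slice f x (r n x))%E @[n --> \oo]
    --> (\int[lebesgue_measure]_(x in `[0%R, 1%R]) S x)%E.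
  have -> : (\int[lebesgue_measure]_(x in `[0%R, 1%R]) S x =
    \int[lebesgue_measure]_(x in `[0%R, 1%R]) limn (fun n => slice f x (r n x)))%E.
    by apply: eq_integral => x _; apply/esym/cvg_lim.
  apply: cvg_monotone_convergence => //.
    by move=> n x _; exact: slice_ge0.
  by move=> x _; exact: running_argmax_nondecreasing.
move=> /cvge_to_le; apply; apply: nearW => n.
apply: ereal_sup_ubound; exists (r n); last exact: Pfg_slice.
split=> // x _.
rewrite /r; have [k _ <-] := running_argmax_in_range (slice f) nnratr n x.
exact: normr_ge0.
Qed.
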